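(* Let $F$ be $\mu$-quasi-strongly monotone with $\mu>0$, and let the key parametric assumption hold with constants $A,B,C,D_1,D_2\ge 0$, $\rho\in(0,1]$ and variables $\{\sigma_k\}_{k\ge0}$. Let $M>B/\rho$ (if $B=0$, take $M=0$ and set $B/M:=0$ in all expressions), and assume that $$0<\gamma\le\min\left\{\frac1\mu,\ \frac{1}{2(A+CM)}\right\}.$$ Let $V_k=\|x^k-x^{*,k}\|^2+M\gamma^2\sigma_k^2$ for $k\ge 0$. Then the iterates of SGDA with constant stepsize $\gamma_k\equiv\gamma$ satisfy, for all $k\ge0$, $$\mathbb{E}[V_k]\le\left(1-\min\left\{\gamma\mu,\ \rho-\frac BM\right\}\right)^k\mathbb{E}[V_0]+\frac{\gamma^2(D_1+MD_2)}{\min\{\gamma\mu,\ \rho-B/M\}}.$$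
   Context: Norms and inner products on $\mathbb{R}^d$ are Euclidean. $F:\mathbb{R}^d\to\mathbb{R}^d$ is an operator and $R:\mathbb{R}^d\to\mathbb{R}\cup\{+\infty\}$ is a proper lower semicontinuous convex function. $X^*$ is the (nonempty) set of solutions of the regularized variational inequality: find $x^*\in\mathbb{R}^d$ with $\langle F(x^* ),x-x^*\rangle+R(x)-R(x^* )\ge0$ for all $x\in\mathbb{R}^d$. $\mathrm{proj}_{X^*}(x)=\arg\min_{y\in X^*}\|y-x\|$ (taken to be well defined). $F$ is $\mu$-quasi-strongly monotone if $\langle F(x)-F(x^* ),x-x^*\rangle\ge\mu\|x-x^*\|^2$ for all $x\in\mathbb{R}^d$, where $x^*=\mathrm{proj}_{X^*}(x)$. SGDA: $x^{k+1}=\mathrm{prox}_{\gamma_k R}(x^k-\gamma_k g^k)$, where $\mathrm{prox}_{\gamma R}(x)=\arg\min_{y}\{R(y)+\|y-x\|^2/(2\gamma)\}$ and $g^k$ is a random vector. Put $x^{*,k}=\mathrm{proj}_{X^*}(x^k)$ and $g^{*,k}=F(x^{*,k})$. $\mathbb{E}_k[\cdot]$ is the expectation with respect to the randomness at iteration $k$, i.e. conditional on everything generated before iteration $k$ (in particular on $x^k,\sigma_k$). Key parametric assumption: for all $k\ge0$, $\mathbb{E}_k[g^k]=F(x^k)$, and there are constants $A,B,C,D_1,D_2\ge0$, $\rho\in(0,1]$ and (possibly random) nonnegative variables $\{\sigma_k\}_{k\ge0}$ such that for all $k\ge0$ $$\mathbb{E}_k\|g^k-g^{*,k}\|^2\le2A\langle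 F(x^k)-g^{*,k},x^k-x^{*,k}\rangle+B\sigma_k^2+D_1,$$ $$\mathbb{E}_k[\sigma_{k+1}^2]\le2C\langle F(x^k)-g^{*,k},x^k-x^{*,k}\rangle+(1-\rho)\sigma_k^2+D_2.$$ Convention: $1/0=+\infty$. *)

(* Defs.v *)
From HB Require Import structures.
From mathcomp Require Import all_boot all_order all_algebra.
From mathcomp Require Import all_classical all_reals all_analysis.
From mathcomp Require Import measurable_realfun.

Set Implicit Arguments.
Unset Strict Implicit.
Unset Printing Implicit Defensive.

Import Order.TTheory GRing.Theory Num.Theory.
Import numFieldNormedType.Exports.

Local Open Scope classical_set_scope.
Local Open Scope ring_scope.

(* The library norm on row vectors is the sup norm, so the Euclidean structure
   is spelled out; both norms induce the same topology. *)
Definition edot (R : realType) (d : nat) (u v : 'rV[R]_d) : R :=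
  \sum_(i < d) u ord0 i * v ord0 i.

Definition enorm (R : realType) (d : nat) (u : 'rV[R]_d) : R :=
  Num.sqrt (edot u u).

Definition eproper (R : realType) (E : Type) (f : E -> \bar R) : Prop :=
  (forall x, f x != -oo%E) /\ (exists x, f x != +oo%E).

(* Jensen's inequality in \bar R, where 0 * +oo = 0. *)
Definition econvex (R : realType) (E : lmodType R) (f : E -> \bar R) : Prop :=
  forall (x y : E) (t : R), 0 <= t <= 1 ->
    (f (t *: x + (1 - t) *: y)%R <= t%:E * f x + (1 - t)%:E * f y)%E.

Definition argmin (E : Type) (disp : Order.disp_t) (V : porderType disp)
    (S : set E) (f : E -> V) : set E :=
  [set y | S y /\ forall z, S z -> (f y <= f z)%O].

(* If Rg is proper, a point with Rg xs = +oo is never a solution: the sum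
   below is then -oo (in particular +oo - +oo = -oo in \bar R). *)
Definition vi_solutions (R : realType) (d : nat)
    (F : 'rV[R]_d -> 'rV[R]_d) (Rg : 'rV[R]_d -> \bar R) : set 'rV[R]_d :=
  [set xs | forall x : 'rV[R]_d,
     (0 <= (edot (F xs) (x - xs))%:E + Rg x - Rg xs)%E].

(* An equality of sets: every x has exactly one nearest point in S. *)
Definition is_projection (R : realType) (d : nat)
    (S : set 'rV[R]_d) (proj : 'rV[R]_d -> 'rV[R]_d) : Prop :=
  forall x, argmin S (fun y => enorm (y - x)) = [set proj x].

Definition quasi_strongly_monotone (R : realType) (d : nat) (mu : R)
    (F proj : 'rV[R]_d -> 'rV[R]_d) : Prop :=
  forall x, mu * enorm (x - proj x) ^+ 2
            <= edot (F x - F (proj x)) (x - proj x).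

Definition is_prox (R : realType) (d : nat) (gamma : R)
    (Rg : 'rV[R]_d -> \bar R) (x p : 'rV[R]_d) : Prop :=
  argmin [set: 'rV[R]_d]
    (fun y => (Rg y + (enorm (y - x) ^+ 2 / (2 * gamma))%:E)%E) = [set p].

Definition sgda (R : realType) (d : nat) (T : Type)
    (Rg : 'rV[R]_d -> \bar R) (gamma : nat -> R)
    (x g : nat -> T -> 'rV[R]_d) : Prop :=
  forall k w,
    is_prox (gamma k) Rg (x k w - gamma k *: g k w) (x k.+1 w).

Definition is_filtration (disp : measure_display) (T : measurableType disp)
    (G : nat -> set (set T)) : Prop :=
  [/\ forall k, sigma_algebra [set: T] (G k),
      forall k, G k `<=` measurable
    & forall k, G k `<=` G k.+1].

(* g_sigma_algebraType G is T equipped with the sigma-algebra <<s G >>, which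
   is G itself when G is a sigma-algebra. *)
Definition measurable_wrt (disp disp' : measure_display)
    (T : measurableType disp) (U : measurableType disp')
    (G : set (set T)) (f : T -> U) : Prop :=
  measurable_fun [set: g_sigma_algebraType G] (f : g_sigma_algebraType G -> U).

Definition measurable_vec_wrt (disp : measure_display)
    (T : measurableType disp) (R : realType) (d : nat)
    (G : set (set T)) (f : T -> 'rV[R]_d) : Prop :=
  forall i : 'I_d, measurable_wrt G (fun w => f w ord0 i).

(* Y is a version of E[X | G], for a nonnegative random variable X; neither
   side need be integrable. *)
Definition is_cond_exp_ge0 (disp : measure_display) (T : measurableType disp)
    (R : realType) (P : probability T R) (G : set (set T))
    (X Y : T -> \bar R) : Prop :=
  [/\ measurable_fun [set: T] X, forall w, (0 <= X w)%E,
      measurable_wrt G Y, forall w, (0 <= Y w)%E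
    & forall A, G A ->
        (\int[P]_(w in A) Y w = \int[P]_(w in A) X w)%E].

(* E[X | G] = Y almost surely, with E[X | G] := E[X^+ | G] - E[X^- | G], both
   terms being almost surely finite (otherwise their difference is infinite,
   as +oo - +oo = -oo in \bar R, and cannot equal the real number Y w).
   Integrability of X is sufficient for this but not required. *)
Definition is_cond_exp (disp : measure_display) (T : measurableType disp)
    (R : realType) (P : probability T R) (G : set (set T))
    (X Y : T -> R) : Prop :=
  exists Yp Yn : T -> \bar R,
    [/\ is_cond_exp_ge0 P G (EFin \o X)^\+%E Yp,
        is_cond_exp_ge0 P G (EFin \o X)^\-%E Yn
      & {ae P, forall w, (Y w)%:E = (Yp w - Yn w)%E}].

Definition is_cond_exp_vec (disp : measure_display) (T : measurableType disp)
    (R : realType) (d : nat) (P : probability T R) (G : set (set T))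
    (X Y : T -> 'rV[R]_d) : Prop :=
  forall i : 'I_d,
    is_cond_exp P G (fun w => X w ord0 i) (fun w => Y w ord0 i).

(* E[X | G] <= Y almost surely, for a nonnegative random variable X. *)
Definition cond_exp_le (disp : measure_display) (T : measurableType disp)
    (R : realType) (P : probability T R) (G : set (set T))
    (X Y : T -> R) : Prop :=
  exists2 Z : T -> \bar R, is_cond_exp_ge0 P G (EFin \o X) Z
    & {ae P, forall w, (Z w <= (Y w)%:E)%E}.

(* The quantity <F x - F xs, x - xs> where xs = proj x. *)
Definition gap (R : realType) (d : nat) (F proj : 'rV[R]_d -> 'rV[R]_d)
    (x : 'rV[R]_d) : R :=
  edot (F x - F (proj x)) (x - proj x).

Definition parametric_assumption (disp : measure_display)
    (T : measurableType disp) (R : realType) (d : nat) (P : probability T R)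
    (G : nat -> set (set T)) (F proj : 'rV[R]_d -> 'rV[R]_d)
    (x g : nat -> T -> 'rV[R]_d) (sigma : nat -> T -> R)
    (A B C D1 D2 rho : R) : Prop :=
  [/\ [/\ 0 <= A, 0 <= B, 0 <= C, 0 <= D1 & 0 <= D2],
      0 < rho <= 1,
      forall k w, 0 <= sigma k w
    & forall k,
      [/\ is_cond_exp_vec P (G k) (g k) (fun w => F (x k w)),
          cond_exp_le P (G k)
            (fun w => enorm (g k w - F (proj (x k w))) ^+ 2)
            (fun w => 2 * A * gap F proj (x k w) + B * sigma k w ^+ 2 + D1)
        & cond_exp_le P (G k)
            (fun w => sigma k.+1 w ^+ 2)
            (fun w => 2 * C * gap F proj (x k w)
                      + (1 - rho) * sigma k w ^+ 2 + D2)]].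

Definition lyapunov (R : realType) (d : nat) (T : Type)
    (proj : 'rV[R]_d -> 'rV[R]_d) (x : nat -> T -> 'rV[R]_d)
    (sigma : nat -> T -> R) (M gamma : R) (k : nat) (w : T) : R :=
  enorm (x k w - proj (x k w)) ^+ 2 + M * gamma ^+ 2 * sigma k w ^+ 2.

(* Main.v *)
(* The prox step is nonexpansive and a solution xs is fixed by
   y |-> prox (y - gamma F y), so with u = x^k - x^{*,k}
     |x^{k+1} - x^{*,k+1}|^2 <= |u - gamma (g^k - g^{*,k})|^2
   pointwise.  Expanding the square, the gap <F x^k - g^{*,k}, u> absorbs the
   gap terms of the parametric assumption as 2 gamma (A + C M) <= 1, and what
   is left of it dominates gamma mu |u|^2, so V_{k+1} <= (1 - r) V_k + c up to
   the fluctuations of g^k, |g^k - g^{*,k}|^2 and sigma_{k+1}^2 around their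
   conditional expectations, which integrate to zero.

   F is not assumed measurable, so g^{*,k} cannot be conditioned upon: it is
   eliminated pointwise, only almost sure bounds by G_k-measurable versions of
   the conditional expectations being integrated.  No integrability is assumed
   either: conditional expectations of nonnegative variables are used, and
   terms are cancelled on events where they are bounded. *)

Require Import Defs.
From HB Require Import structures.
From mathcomp Require Import all_boot all_order all_algebra.
From mathcomp Require Import all_classical all_reals all_analysis.
From mathcomp Require Import measurable_realfun.
From mathcomp Require Import ring lra.

Set Implicit Arguments.
Unset Strict Implicit.
Unset Printing Implicit Defensive.

Import Order.TTheory GRing.Theory Num.Theory.
Import numFieldNormedType.Exports.
Import HBNNSimple.

Local Open Scope classical_set_scope.
Local Open Scope ring_scope.

(** * Euclidean inner product and norm *)

Section Euclid.
Variables (R : realType) (d : nat).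
Implicit Types (u v w : 'rV[R]_d) (c : R).

Lemma edotC u v : edot u v = edot v u.
Proof. by apply: eq_bigr => i _; rewrite mulrC. Qed.

Lemma edotDl u v w : edot (u + v) w = edot u w + edot v w.
Proof. by rewrite /edot -big_split; apply: eq_bigr => i _; rewrite mxE mulrDl. Qed.

Lemma edotZl c u v : edot (c *: u) v = c * edot u v.
Proof. by rewrite /edot mulr_sumr; apply: eq_bigr => i _; rewrite mxE mulrA. Qed.

Lemma edotNl u v : edot (- u) v = - edot u v.
Proof. by rewrite -scaleN1r edotZl mulN1r. Qed.

Lemma edotDr u v w : edot w (u + v) = edot w u + edot w v.
Proof. by rewrite !(edotC w) edotDl. Qed.

Lemma edotZr c u v : edot u (c *: v) = c * edot u v.
Proof. by rewrite !(edotC u) edotZl. Qed.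

Lemma edotNr u v : edot u (- v) = - edot u v.
Proof. by rewrite !(edotC u) edotNl. Qed.

Definition edot_linear := (edotDl, edotDr, edotNl, edotNr, edotZl, edotZr).

Lemma edot_ge0 u : 0 <= edot u u.
Proof. by apply: sumr_ge0 => i _; rewrite -expr2 sqr_ge0. Qed.

Lemma enorm_sqr u : enorm u ^+ 2 = edot u u.
Proof. by rewrite sqr_sqrtr ?edot_ge0. Qed.

Lemma enorm_ge0 u : 0 <= enorm u. Proof. exact: sqrtr_ge0. Qed.

Lemma enormN u : enorm (- u) = enorm u.
Proof. by rewrite /enorm !edot_linear opprK. Qed.

Lemma ler_coord_enorm u i : `|u ord0 i| <= enorm u.
Proof.
rewrite -sqrtr_sqr ler_wsqrtr// /edot (bigD1 i)//= expr2 lerDl.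
by apply: sumr_ge0 => j _; rewrite -expr2 sqr_ge0.
Qed.

(** The topology is that of the sup norm; this bound gives definiteness of the Euclidean norm and,
    later, boundedness of Euclidean balls. *)
Lemma ler_norm_enorm u : `|u| <= enorm u.
Proof.
rewrite [leLHS]mx_normrE; apply/bigmax_leP; split=> [|[i j] _]; first exact: enorm_ge0.
by rewrite ord1 ler_coord_enorm.
Qed.

Lemma enorm_eq0 u : enorm u = 0 -> u = 0.
Proof.
by move=> u0; apply/normr0_eq0/le_anti; rewrite normr_ge0 -u0 ler_norm_enorm.
Qed.

(** The square |(v.v) u - (u.v) v|^2 is nonnegative and equals v.v times the defect (u.u)(v.v) -
    (u.v)^2. *)
Lemma edot_cauchy_schwarz u v : edot u v <= enorm u * enorm v.
Proof.
have [/enorm_eq0 ->|v0] := eqVneq (enorm v) 0.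
  by rewrite -[X in edot _ X](scale0r v) edotZr mul0r mulr_ge0 ?enorm_ge0.
have vgt0 : 0 < enorm v by rewrite lt_neqAle eq_sym v0 enorm_ge0.
apply/ler_normlW; rewrite -ler_sqr ?nnegrE ?mulr_ge0 ?enorm_ge0//.
rewrite real_normK ?num_real// exprMn !enorm_sqr.
rewrite -(ler_pM2r (exprn_gt0 2 vgt0)) -subr_ge0.
have := edot_ge0 (edot v v *: u - edot u v *: v).
rewrite !edot_linear (edotC v u) !enorm_sqr.
by congr (0 <= _); ring.
Qed.

Lemma ler_enormD u v : enorm (u + v) <= enorm u + enorm v.
Proof.
rewrite -ler_sqr ?nnegrE ?addr_ge0 ?enorm_ge0// sqrrD !enorm_sqr.
have := edot_cauchy_schwarz u v.
rewrite !edot_linear (edotC v u); lra.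
Qed.

End Euclid.

(** * The proximal step *)

Section Prox.
Variables (R : realType) (d : nat) (Rg : 'rV[R]_d -> \bar R).
Hypotheses (Rg_proper : eproper Rg) (Rg_convex : econvex Rg).

(** The prox objective is finite at some point [y0] by properness, hence also at its minimiser. *)
Lemma is_prox_fin_num gamma z p : is_prox gamma Rg z p -> Rg p \is a fin_num.
Proof.
move=> pz; have [ninfty [y0 y0y]] := Rg_proper.
have y0fin : Rg y0 \is a fin_num by rewrite fin_numE ninfty.
have [_ /(_ y0 I)] : argmin [set: 'rV[R]_d]
    (fun y => (Rg y + (enorm (y - z) ^+ 2 / (2 * gamma))%:E)%E) p by rewrite pz.
rewrite fin_numE ninfty -(fineK y0fin) /=.
by case: (Rg p).
Qed.

(* Letting t -> 0 in the comparison of p with t y + (1 - t) p. *)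
Lemma is_prox_variational gamma z p y : 0 < gamma ->
  is_prox gamma Rg z p -> Rg y \is a fin_num ->
  edot (z - p) (y - p) <= gamma * (fine (Rg y) - fine (Rg p)).
Proof.
move=> gamma0 pz yfin; have pfin := is_prox_fin_num pz.
have [_ pmin] : argmin [set: 'rV[R]_d]
    (fun y => (Rg y + (enorm (y - z) ^+ 2 / (2 * gamma))%:E)%E) p by rewrite pz.
set q := edot (y - p) (y - p).
pose D := edot (z - p) (y - p) - gamma * (fine (Rg y) - fine (Rg p)).
have Dt t : 0 < t <= 1 -> 2 * D <= t * q.
  move=> /andP[t0 t1].
  have := @Rg_convex y p t; rewrite t1 ltW// => /(_ isT) cvx.
  have := le_trans (pmin (t *: y + (1 - t) *: p) I) (leeD2r _ cvx).
  rewrite -(fineK yfin) -(fineK pfin) -!EFinM -!EFinD lee_fin !enorm_sqr.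
  rewrite -(ler_pM2r (_ : 0 < 2 * gamma)) ?mulr_gt0//.
  rewrite [X in X <= _]mulrDl [X in _ <= X]mulrDl !divfK ?gt_eqF ?mulr_gt0//.
  have -> : t *: y + (1 - t) *: p - z = t *: (y - p) - (z - p).
    by apply/rowP => i; rewrite !mxE; ring.
  have -> : p - z = - (z - p) by rewrite opprB.
  rewrite !edotDl !edotNl !edotZl -/(edot (y - p)) => H.
  rewrite -(ler_pM2l t0).
  move: H; rewrite ![edot _ (_ - (z - p))]edotDr ![edot _ (t *: _)]edotZr.
  rewrite ![edot _ (- (z - p))]edotNr (edotC (y - p) (z - p)) /D -/q; lra.
rewrite -subr_le0 -/D leNgt; apply/negP => D0.
have q0 : 0 <= q by exact: edot_ge0.
have S0 : 0 < D + q + 1 by lra.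
(* For [D > 0] this is an admissible [t], and [2 * D <= t * q] would give [2 * (D + q + 1) <= q]. *)
have : 0 < D / (D + q + 1) <= 1 by rewrite divr_gt0// ler_pdivrMr//; lra.
move=> /Dt; rewrite mulrAC ler_pdivlMr// -mulrA mulrCA ler_pM2l//; lra.
Qed.

Variable F : 'rV[R]_d -> 'rV[R]_d.

(* A solution xs is the fixed point prox (xs - gamma F xs) = xs. *)
Lemma is_prox_contraction gamma x g xs p : 0 < gamma ->
  vi_solutions F Rg xs -> is_prox gamma Rg (x - gamma *: g) p ->
  enorm (p - xs) ^+ 2 <= enorm (x - xs - gamma *: (g - F xs)) ^+ 2.
Proof.
move=> gamma0 /(_ p) xsp pz; have pfin := is_prox_fin_num pz.
(* Since [Rg p] is finite, [Rg xs = +oo] would make the variational inequality at [p] read 0 <=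
   -oo. *)
have xsfin : Rg xs \is a fin_num.
  move: xsp; rewrite fin_numE Rg_proper.1 -(fineK pfin) /=.
  by case: (Rg xs).
have := is_prox_variational gamma0 pz xsfin.
have : 0 <= edot (F xs) (p - xs) + fine (Rg p) - fine (Rg xs).
  by rewrite -lee_fin EFinB EFinD !fineK.
rewrite -(pmulr_rge0 _ gamma0) !enorm_sqr.
(* The prox inequality tested at [xs] and gamma times the variational inequality at [p] add up to
   <v, u> <= 0: the values of [Rg] cancel. Hence |v - u|^2 >= |u|^2. *)
set u := xs - p; set v := x - gamma *: (g - F xs) - p.
have -> : x - xs - gamma *: (g - F xs) = v - u.
  by apply/rowP => i; rewrite !mxE; ring.
have -> : x - gamma *: g - p = v - gamma *: F xs.
  by apply/rowP => i; rewrite !mxE; ring.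
have -> : p - xs = - u by rewrite opprB.
have := edot_ge0 v; clearbody u v.
rewrite !edot_linear (edotC u v); lra.
Qed.

End Prox.

(** * Conditional expectations of nonnegative variables *)

Section CondExp.
Context {disp : measure_display} {T : measurableType disp} {R : realType}.
Variables (P : probability T R) (G : set (set T)).
Hypotheses (sG : sigma_algebra [set: T] G) (GT : G `<=` measurable).

Lemma measurable_wrt_preimage {disp'} {U : measurableType disp'} (f : T -> U) B :
  measurable_wrt G f -> measurable B -> G (f @^-1` B).
Proof.
move=> mf mB; have := mf measurableT B mB.
by rewrite setTI /measurable/= sigma_algebra_id.
Qed.

Lemma measurable_wrt_measurable {disp'} {U : measurableType disp'} (f : T -> U) :
  measurable_wrt G f -> measurable_fun [set: T] f.
Proof.
by move=> mf _ B mB; rewrite setTI; exact/GT/measurable_wrt_preimage.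
Qed.

Implicit Types X Y : T -> \bar R.

Lemma is_cond_exp_ge0D X X' Y Y' :
  is_cond_exp_ge0 P G X Y -> is_cond_exp_ge0 P G X' Y' ->
  is_cond_exp_ge0 P G (X \+ X')%E (Y \+ Y')%E.
Proof.
move=> [mX X0 mY Y0 XY] [mX' X'0 mY' Y'0 XY']; split.
- exact: emeasurable_funD.
- by move=> w; rewrite adde_ge0.
- exact: emeasurable_funD.
- by move=> w; rewrite adde_ge0.
- move=> A GA; have mA := GT GA.
  have mYT := measurable_wrt_measurable mY.
  have mYT' := measurable_wrt_measurable mY'.
  by rewrite !ge0_integralD// ?XY ?XY'//; exact: measurable_funTS.
Qed.

Lemma is_cond_exp_ge0_cst0 : is_cond_exp_ge0 P G (cst 0%E) (cst 0%E).
Proof. by split=> //; exact: measurable_cst. Qed.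

Lemma is_cond_exp_ge0_sum (I : Type) (s : seq I) (X Y : I -> T -> \bar R) :
  (forall i, is_cond_exp_ge0 P G (X i) (Y i)) ->
  is_cond_exp_ge0 P G (fun w => \sum_(i <- s) X i w)%E (fun w => \sum_(i <- s) Y i w)%E.
Proof.
move=> XY; elim: s => [|i s IHs].
  under eq_fun do rewrite big_nil.
  under [X in is_cond_exp_ge0 _ _ _ X]eq_fun do rewrite big_nil.
  exact: is_cond_exp_ge0_cst0.
under eq_fun do rewrite big_cons.
under [X in is_cond_exp_ge0 _ _ _ X]eq_fun do rewrite big_cons.
exact: is_cond_exp_ge0D.
Qed.

(** Taking out what is known: for a simple [phi] the integral splits over level sets, which lie in
    [G]; the general case follows by monotone convergence. *)
Lemma is_cond_exp_ge0M X Y (phi : T -> R) :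
  measurable_wrt G phi -> (forall w, 0 <= phi w) ->
  is_cond_exp_ge0 P G X Y ->
  is_cond_exp_ge0 P G (fun w => (phi w)%:E * X w)%E (fun w => (phi w)%:E * Y w)%E.
Proof.
move=> mphi phi0 [mX X0 mY Y0 XY].
have mphiT := measurable_wrt_measurable mphi.
have mYT := measurable_wrt_measurable mY.
split.
- by apply: emeasurable_funM => //; exact/measurable_EFinP.
- by move=> w; rewrite mule_ge0// lee_fin.
- by apply: emeasurable_funM => //; exact/measurable_EFinP.
- by move=> w; rewrite mule_ge0// lee_fin.
move=> A GA; have mA := GT GA.
pose TG : measurableType _ := g_sigma_algebraType G.
have mphiE : measurable_fun [set: TG] (EFin \o phi : TG -> \bar R).
  exact/measurable_EFinP.
have phi0E (w : TG) : [set: TG] w -> (0 <= (EFin \o phi) w)%E by rewrite /= lee_fin.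
(* The approximation is built over [TG] rather than [T], so that the level sets of [h n] belong to
   [G]. *)
pose h := nnsfun_approx measurableT mphiE.
have mhG n : measurable_wrt G (h n : TG -> R) by exact: measurable_funPT.
have mh n y : G ((h n : TG -> R) @^-1` [set y]).
  exact: measurable_wrt_preimage (mhG n) (measurable_set1 y).
have mhT n : measurable_fun [set: T] (h n : TG -> R).
  exact: measurable_wrt_measurable (mhG n).
have h0 n w : 0 <= h n w by [].
have nd_h w : {homo (fun n => h n w) : m n / (m <= n)%N >-> m <= n}.
  by move=> m n mn; exact/lefP/nd_nnsfun_approx.
have cvg_h w : (EFin \o (fun n => h n w)) n @[n --> \oo] --> (phi w)%:E.
  exact: (cvg_nnsfun_approx measurableT mphiE phi0E).
have h_le n w : h n w <= phi w.
  rewrite -lee_fin; apply: cvge_ge (cvg_h w); near=> m.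
  by rewrite lee_fin nd_h//; near: m; exact: nbhs_infty_ge.
have lim_h Z : measurable_fun [set: T] Z -> (forall w, 0 <= Z w)%E ->
    (\int[P]_(w in A) ((h n w)%:E * Z w))%E @[n --> \oo] -->
    (\int[P]_(w in A) ((phi w)%:E * Z w))%E.
  move=> mZ Z0.
  rewrite [X in _ --> X](_ : _ =
      \int[P]_(w in A) limn (fun n => (h n w)%:E * Z w))%E; last first.
    apply: eq_integral => w _; apply/esym/cvg_lim => //.
    (* The product is not continuous at 0 * +oo, so zeros of [phi] are treated apart: every [h n]
       vanishes there too. *)
    have [pw0|pw0] := eqVneq (phi w) 0.
      rewrite pw0 mul0e; under eq_fun => n.
        rewrite (_ : h n w = 0) ?mul0e; last by apply/le_anti; rewrite h0 -{1}pw0 h_le.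
        over.
      exact: cvg_cst.
    apply: cvgeM; [|exact: cvg_h|exact: cvg_cst].
    have [?|?] := boolP (Z w \is a fin_num); first exact: mule_def_fin.
    exact: mule_def_neq0_infty.
  apply: cvg_monotone_convergence => //.
  - move=> n; apply: measurable_funTS; apply: emeasurable_funM => //.
    exact/measurable_EFinP.
  - by move=> n w _; rewrite mule_ge0// lee_fin.
  - by move=> w _ m n mn; rewrite lee_wpmul2r// lee_fin nd_h.
have int_h n Z : measurable_fun [set: T] Z -> (forall w, 0 <= Z w)%E ->
    (\int[P]_(w in A) ((h n w)%:E * Z w) =
     \sum_(y \in range (h n))
       (y%:E * \int[P]_(w in A `&` (h n : TG -> R) @^-1` [set y]) Z w))%E.
  move=> mZ Z0.
  (* Here [y] is any real: a value not taken by [h n] has an empty level set, so negative [y]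
     contribute 0. *)
  have ind0 y w : 0 <= y * \1_((h n : TG -> R) @^-1` [set y]) w.
    have [[v hv]|hy] := pselect (exists v, h n v = y).
      by rewrite -hv mulr_ge0.
    by rewrite indicE memNset ?mulr0// => hw; apply: hy; exists w.
  under eq_integral => w _.
    rewrite fimfunE -fsumEFin// ge0_mule_fsuml; last by move=> y; rewrite lee_fin.
    over.
  rewrite ge0_integral_fsum//; last 2 first.
  - move=> y; apply: measurable_funTS; apply: emeasurable_funM => //.
    apply/measurable_EFinP/measurable_funM => //.
    by apply: measurable_indic; exact: GT (mh n y).
  - by move=> y w _; rewrite mule_ge0// lee_fin.
  apply: eq_fsbigr => y /set_mem[v _ hv].
  under eq_integral do rewrite EFinM -muleA.
  have mE := GT (mh n y).
  rewrite ge0_integralZl//; last 3 first.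
  - apply: measurable_funTS; apply: emeasurable_funM => //.
    exact/measurable_EFinP/measurable_indic.
  - by move=> w _; rewrite mule_ge0// lee_fin.
  - by rewrite lee_fin -hv.
  rewrite integral_mkcondr; congr (_ * _)%E; apply: eq_integral => w _.
  by rewrite patchE indicE; case: ifPn => _; rewrite ?mul1e ?mul0e.
have hXY : (fun n => \int[P]_(w in A) ((h n w)%:E * X w))%E =
           (fun n => \int[P]_(w in A) ((h n w)%:E * Y w))%E.
  apply/funext => n; rewrite !int_h//; apply: eq_fsbigr => y _; rewrite XY//.
  have : @measurable _ TG (A `&` (h n : TG -> R) @^-1` [set y]).
    by apply: measurableI; rewrite /measurable/= sigma_algebra_id.
  by rewrite /measurable/= sigma_algebra_id.
have /cvg_lim <- // := lim_h _ mYT Y0.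
by have /cvg_lim := lim_h _ mX X0; rewrite hXY; apply.
Unshelve. all: by end_near. Qed.

(* Localising to the events {Y + Y' <= n} makes every cancelled term finite. *)
Lemma cond_exp_cancel (X Y X' Y' W H : T -> \bar R) :
  is_cond_exp_ge0 P G X Y -> is_cond_exp_ge0 P G X' Y' ->
  {ae P, forall w, Y w + Y' w < +oo}%E ->
  measurable_fun [set: T] W -> (forall w, 0 <= W w)%E ->
  measurable_fun [set: T] H -> (forall w, 0 <= H w)%E ->
  {ae P, forall w, W w + (X w + Y' w) <= X' w + Y w + H w}%E ->
  (\int[P]_w W w <= \int[P]_w H w)%E.
Proof.
move=> [mX X0 mY Y0 XY] [mX' X'0 mY' Y'0 XY'] Yfin mW W0 mH H0 WH.
have mYT := measurable_wrt_measurable mY.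
have mYT' := measurable_wrt_measurable mY'.
pose A n := [set w | Y w + Y' w <= n%:R%:E]%E.
have GA n : G (A n).
  pose S := (Y \+ Y')%E.
  have mS : measurable_wrt G S by exact: emeasurable_funD.
  rewrite (_ : A n = S @^-1` `]-oo, n%:R%:E]%classic); last first.
    by apply/seteqP; split=> w /=; rewrite in_itv/=.
  by apply: measurable_wrt_preimage => //; exact: emeasurable_itv.
have mA n := GT (GA n).
have WHA n : (\int[P]_(w in A n) W w <= \int[P]_(w in A n) H w)%E.
  have mA_ (f : T -> \bar R) : measurable_fun [set: T] f -> measurable_fun (A n) f
    by exact: measurable_funTS.
  have fin : (\int[P]_(w in A n) (Y w + Y' w) < +oo)%E.
    apply: (@le_lt_trans _ _ (\int[P]_(w in A n) n%:R%:E))%E.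
      apply: ge0_le_integral => //.
      + by move=> w _; rewrite adde_ge0.
      + by apply: mA_; exact: emeasurable_funD.
    rewrite integral_cst//; apply: lte_mul_pinfty; rewrite ?lee_fin//.
    exact: (le_lt_trans (probability_le1 P (mA n))) (ltry _).
  have : (\int[P]_(w in A n) (W w + (X w + Y' w)) <=
          \int[P]_(w in A n) (X' w + Y w + H w))%E.
    apply: ae_ge0_le_integral => //.
    + by move=> w _; rewrite !adde_ge0.
    + by apply: mA_; apply: emeasurable_funD => //; exact: emeasurable_funD.
    + by move=> w _; rewrite !adde_ge0.
    + by apply: mA_; apply: emeasurable_funD => //; exact: emeasurable_funD.
    + by apply: filterS WH => w Ww _.
  rewrite ge0_integralD//; [|exact: mA_|by move=> w _; rewrite adde_ge0|
    by apply: mA_; exact: emeasurable_funD].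
  rewrite ge0_integralD//; [|exact: mA_|exact: mA_].
  rewrite [X in (_ <= X)%E]ge0_integralD//; [|by move=> w _; rewrite adde_ge0|
    by apply: mA_; exact: emeasurable_funD|exact: mA_].
  rewrite [X in (_ <= X + _)%E]ge0_integralD//; [|exact: mA_|exact: mA_].
  move: fin; rewrite ge0_integralD//; [|exact: mA_|exact: mA_].
  (* As [A n] is in [G], the integrals of [X] and [X'] over it become those of [Y] and [Y']; both
     sides then share a finite term. *)
  rewrite -(XY _ (GA n)) -(XY' _ (GA n)) => fin.
  rewrite [X in (_ + X <= _)%E -> _]addeC [X in (_ <= X)%E -> _]addeC.
  rewrite [X in (_ + X <= _)%E -> _]addeC [X in (_ <= _ + X)%E -> _]addeC.
  rewrite leeD2rE// ge0_fin_numE// adde_ge0//; exact: integral_ge0.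
pose U := \bigcup_n A n.
have cvW Z : measurable_fun [set: T] Z -> (forall w, 0 <= Z w)%E ->
    (\int[P]_(w in A n) Z w)%E @[n --> \oo] --> (\int[P]_(w in U) Z w)%E.
  move=> mZ Z0; apply: ge0_nondecreasing_set_cvg_integral => //.
  - move=> m n mn; apply/subsetPset => w /= /le_trans; apply.
    by rewrite lee_fin ler_nat.
  - by move=> n; exact: measurable_funTS.
have mU : measurable U by exact: bigcupT_measurable.
(* [U] contains every point where [Y + Y'] is finite, so its complement is negligible. *)
have intU Z : measurable_fun [set: T] Z -> (forall w, 0 <= Z w)%E ->
    (\int[P]_(w in U) Z w = \int[P]_w Z w)%E.
  move=> mZ Z0.
  rewrite integral_mkcond; apply: ge0_ae_eq_integral => //.
  - by apply/(measurable_restrictT _ _).1 => //; exact: measurable_funTS.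
  - by move=> w _; rewrite patchE; case: ifP.
  - apply: filterS Yfin => w Yw _; rewrite patchE mem_set//.
    have Yw0 : (0 <= Y w + Y' w)%E by rewrite adde_ge0.
    exists (Num.bound (fine (Y w + Y' w)%E)) => //=.
    rewrite /A /= -[leLHS]fineK ?ge0_fin_numE// lee_fin ltW//.
    exact/archi_boundP/fine_ge0.
rewrite -!intU//; have cW := cvW _ mW W0; have cH := cvW _ mH H0.
rewrite -(cvg_lim _ cW)// -(cvg_lim _ cH)//; apply: lee_lim.
- exact: cvgP cW.
- exact: cvgP cH.
- exact: nearW.
Qed.

End CondExp.

(** * Closedness of the target set and continuity of the projection *)

Section Projection.
Variables (R : realType) (d : nat).
Implicit Types u v : 'rV[R]_d.

Lemma enorm_continuous : continuous (@enorm R d).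
Proof.
have cdot : continuous (fun u : 'rV[R]_d => edot u u).
  apply: continuous_big => [z|i _ u].
    exact: (@cvgD R R^o _ _ _ fst snd z.1 z.2 cvg_fst cvg_snd).
  have cu := @coord_continuous R 1 d ord0 i u.
  exact: (cvgM cu cu).
by move=> u; apply: continuous_comp; [exact: cdot|exact: sqrt_continuous].
Qed.

Lemma enorm_sub_continuous a : continuous (fun u => enorm (u - a)).
Proof.
move=> u; apply: continuous_comp; last exact: enorm_continuous.
exact: (cvgB (@cvg_id _ (nbhs u)) (cvg_cst a)).
Qed.

Variables (S : set 'rV[R]_d) (proj : 'rV[R]_d -> 'rV[R]_d).
Hypothesis projP : is_projection S proj.

Lemma is_projection_mem a : S (proj a).
Proof. by have [] : argmin S (fun y => enorm (y - a)) (proj a) by rewrite projP. Qed.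

Lemma is_projection_min a y : S y -> enorm (proj a - a) <= enorm (y - a).
Proof.
have [_ amin] : argmin S (fun y => enorm (y - a)) (proj a) by rewrite projP.
exact: amin.
Qed.

Lemma is_projection_unique a y :
  S y -> enorm (y - a) <= enorm (proj a - a) -> y = proj a.
Proof.
move=> Sy ya; have : argmin S (fun y => enorm (y - a)) y.
  by split=> // z Sz; exact: le_trans ya (is_projection_min a Sz).
by rewrite projP.
Qed.

(** Every [y] in [S] satisfies |proj a - a| <= |y - a|. This condition is closed in [y], so it holds
    at an adherent point [a] itself and forces [proj a = a]. *)
Lemma is_projection_closed : closed S.
Proof.
move=> a cSa; suff <- : proj a = a by exact: is_projection_mem.
apply/subr0_eq/enorm_eq0/le_anti; rewrite enorm_ge0 andbT.
have -> : 0 = enorm (a - a) by rewrite subrr -(scale0r a) /enorm edotZl mul0r sqrtr0.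
have cl : closed [set y | enorm (proj a - a) <= enorm (y - a)].
  exact: (continuous_closedP _).1 (@enorm_sub_continuous a) _ (@closed_ge _ _).
suff : [set y | enorm (proj a - a) <= enorm (y - a)] a by [].
rewrite ((closure_id _).1 cl); apply: closureS cSa => y.
exact: is_projection_min.
Qed.

(* By compactness it suffices to identify the cluster points of proj at a, and
   these are again nearest points to a. *)
Lemma is_projection_continuous : continuous proj.
Proof.
move=> a.
pose V := [set y | enorm (y - a) <= enorm (proj a - a) + 1].
have closed_ball r : closed [set y : 'rV[R]_d | enorm (y - a) <= r].
  exact: (continuous_closedP _).1 (@enorm_sub_continuous a) _ (@closed_le _ r).
(* |proj x - a| <= |proj x - x| + |x - a| <= |z - x| + |x - a|, which tends to |z - a| as [x] tends
   to [a]. *)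
have near_proj z e : S z -> 0 < e ->
    \forall x \near a, enorm (proj x - a) <= enorm (z - a) + e.
  move=> Sz e0.
  have c : (fun x => enorm (x - z) + enorm (x - a)) x @[x --> a] -->
      enorm (a - z) + enorm (a - a).
    exact: (cvgD (@enorm_sub_continuous z a) (@enorm_sub_continuous a a)).
  have a0 : enorm (a - a) = 0 by rewrite subrr -(scale0r a) /enorm edotZl mul0r sqrtr0.
  move/cvgr_le : c; rewrite a0 addr0 => /(_ (enorm (z - a) + e)) H.
  have : enorm (a - z) < enorm (z - a) + e by rewrite -enormN opprB ltrDl.
  move=> /H; apply: filterS => x /(le_trans _); apply.
  rewrite -(subrKA x (proj x)) (le_trans (ler_enormD _ _))// lerD2r.
  by rewrite -(enormN (x - z)) opprB is_projection_min.
have FV : (proj @ a) V by exact: near_proj (is_projection_mem a) ltr01.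
have cV : compact V.
  apply: bounded_closed_compact; last exact: closed_ball.
  exists (enorm (proj a - a) + 1 + `|a|); split; first exact: num_real.
  move=> r /ltW ar y Vy; apply: le_trans ar.
  rewrite -(subrK a y) (le_trans (ler_normD _ _))// lerD2r.
  exact: le_trans (ler_norm_enorm _) Vy.
have cluster_sub y : cluster (proj @ a) y -> y = proj a.
  rewrite clusterE => cy.
  (* A cluster point lies in every closed set that contains [proj x] for [x] near [a]: in [S], and
     in each ball around [a] of radius |proj a - a| + e. *)
  apply: is_projection_unique.
    rewrite (closure_id S).1; last exact: is_projection_closed.
    by apply: cy; rewrite /= (_ : proj @^-1` S = setT);
      [exact: (@filterT _ (nbhs a))|
       apply/seteqP; split=> // x _; exact: is_projection_mem].
  apply/ler_addgt0Pr => e e0.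
  have := cy [set y | enorm (y - a) <= enorm (proj a - a) + e].
  rewrite -(closure_id _).1; last exact: closed_ball.
  by apply; exact: near_proj (is_projection_mem a) e0.
apply: (@compact_cluster_set1 'rV[R]_d _ _ V) => //.
- have /cvgr_le := @enorm_sub_continuous a (proj a); apply.
  by rewrite ltrDl.
- exact: (@fmap_proper_filter _ _ proj (nbhs a)).
- apply/seteqP; split=> [y /cluster_sub //|_ ->].
  by have [y [_ cy]] := cV _ (@fmap_proper_filter _ _ proj (nbhs a) _) FV;
    rewrite -(cluster_sub _ cy).
Qed.

Lemma is_projection_residual_continuous : continuous (fun v => v - proj v).
Proof.
by move=> v; exact: (cvgB (@cvg_id _ (nbhs v)) (@is_projection_continuous v)).
Qed.

End Projection.

(** * Measurability of continuous functions of random vectors *)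

Section RowMeasurable.
Variables (disp : measure_display) (T : measurableType disp) (R : realType) (d : nat).

(* Rounding X coordinatewise to (n+1)^-1 Z^d gives countably-valued measurable
   approximations. *)
Lemma measurable_fun_continuous_row (X : T -> 'rV[R]_d) (f : 'rV[R]_d -> R) :
  continuous f -> (forall i, measurable_fun [set: T] (fun w => X w ord0 i)) ->
  measurable_fun [set: T] (f \o X).
Proof.
move=> cf mX.
pose r n (v : 'rV[int]_d) : 'rV[R]_d := \row_i ((v ord0 i)%:~R / n.+1%:R).
pose q n w : 'rV[int]_d := \row_i Num.floor (n.+1%:R * X w ord0 i).
apply: (@measurable_fun_cvg _ _ _ _ (fun n => f \o r n \o q n)) => [n _ B mB|w _].
  (* The approximation is constant on each cell of [q n]; there are countably many cells, each a
     finite intersection of coordinate slabs. *)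
  rewrite setTI [X in measurable X](_ : _ =
    \bigcup_(v : 'rV[int]_d) (q n @^-1` [set v] `&` [set w | B (f (r n v))])); last first.
    apply/seteqP; split=> [w Bw|w [v _ [<-]]//].
    by exists (q n w).
  apply: countable_bigcupT_measurable => [|v]; first exact: countableP.
  apply: measurableI.
    rewrite (_ : _ @^-1` _ = \bigcap_(i : 'I_d) ((fun w => X w ord0 i) @^-1`
      `[(v ord0 i)%:~R / n.+1%:R, (v ord0 i + 1)%:~R / n.+1%:R[%classic)); last first.
      apply/seteqP; split=> [w <- i _ /=|w Hw].
        rewrite mxE in_itv/= ler_pdivrMr// ltr_pdivlMr// mulrC.
        exact: floor_itv.
      apply/rowP => i; rewrite mxE; apply/floor_def.
      have := Hw i I; rewrite /= in_itv/= ler_pdivrMr// ltr_pdivlMr//.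
      by rewrite mulrC.
    apply: fin_bigcap_measurable => [|i _]; first exact: finite_finset.
    by rewrite -[_ @^-1` _]setTI; exact: mX.
  have [Bv|Bv] := pselect (B (f (r n v))).
    by have -> : [set w : T | B (f (r n v))] = setT by apply/seteqP; split.
  by have -> : [set w : T | B (f (r n v))] = set0 by apply/seteqP; split.
apply: continuous_cvg; first exact: cf.
apply/cvgrPdist_le => e e0.
near=> n.
rewrite [leLHS]mx_normrE; apply/bigmax_leP; split=> [|[i j] _]; first exact: ltW.
rewrite ord1 !mxE /=; apply: (@le_trans _ _ n.+1%:R^-1); last first.
  by apply: ltW; near: n; exact: (near_infty_natSinv_lt (PosNum e0)).
have /andP[fl fu] := floor_itv (n.+1%:R * X w ord0 j).
rewrite -(ler_pM2r (ltr0Sn R n)) mulVf// -[X in _ * X]gtr0_norm// -normrM.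
rewrite mulrBl divfK// mulrC ler_norml; move: fl fu; rewrite intrD; lra.
Unshelve. all: by end_near. Qed.

End RowMeasurable.

Lemma positive_part_sub (R : realDomainType) (a : R) :
  Num.max a 0 - Num.max (- a) 0 = a.
Proof.
have [a0|a0] := ltP 0 a.
  by rewrite max_r ?subr0// oppr_le0 ltW.
by rewrite max_l ?sub0r ?opprK// oppr_ge0.
Qed.

(** * One-step descent of the Lyapunov function *)

Section Step.
Context {R : realType} {d : nat} {disp : measure_display} {T : measurableType disp}.
Variables (P : probability T R) (F : 'rV[R]_d -> 'rV[R]_d) (Rg : 'rV[R]_d -> \bar R).
Hypotheses (Rg_proper : eproper Rg) (Rg_convex : econvex Rg).
Variable proj : 'rV[R]_d -> 'rV[R]_d.
Hypothesis projP : is_projection (vi_solutions F Rg) proj.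
Variable mu : R.
Hypotheses (mu_gt0 : 0 < mu) (F_qsm : quasi_strongly_monotone mu F proj).

Lemma lyapunov_ge0 (x : nat -> T -> 'rV[R]_d) sigma M gamma k w :
  0 <= M -> 0 <= lyapunov proj x sigma M gamma k w.
Proof.
move=> M0; rewrite /lyapunov addr_ge0 ?sqr_ge0//.
by rewrite mulr_ge0 ?sqr_ge0// mulr_ge0 ?sqr_ge0.
Qed.

(** The residual [v - proj v] is continuous in [v], so its norm along the measurable vector [x k] is
    measurable. *)
Lemma lyapunov_measurable_wrt (G : set (set T)) (x : nat -> T -> 'rV[R]_d)
    sigma M gamma k :
  measurable_vec_wrt G (x k) -> measurable_wrt G (sigma k) ->
  measurable_wrt G (lyapunov proj x sigma M gamma k).
Proof.
move=> mx ms; rewrite /measurable_wrt /lyapunov.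
apply: measurable_funD; last first.
  by apply: measurable_funM => //; exact: measurable_funX.
apply: measurable_funX.
apply: (@measurable_fun_continuous_row _ (g_sigma_algebraType G) _ _ (x k)
  (fun v => enorm (v - proj v))) => // v.
apply: (@continuous_comp 'rV[R]_d 'rV[R]_d R (fun v => v - proj v) (@enorm R d)).
  exact: is_projection_residual_continuous projP _.
exact: enorm_continuous.
Qed.

Variables (A B C D1 D2 rho M gamma r : R).
Hypotheses (M_ge0 : 0 <= M) (gamma_gt0 : 0 < gamma).
Hypotheses (r_le1 : r <= 1) (r_mu : r <= gamma * mu) (r_rho : B <= M * (rho - r)).
Hypothesis gamma_le : 2 * gamma * (A + C * M) <= 1.

(** Here [z1] and [z2] stand for values of the conditional expectations. Each random term and its
    conditional counterpart are on opposite sides, the shape required by [cond_exp_cancel]. *)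
Lemma sgda_descent (x g p : 'rV[R]_d) (sigma sigma' z1 z2 : R) :
  is_prox gamma Rg (x - gamma *: g) p ->
  z1 <= 2 * A * gap F proj x + B * sigma ^+ 2 + D1 ->
  z2 <= 2 * C * gap F proj x + (1 - rho) * sigma ^+ 2 + D2 ->
  enorm (p - proj p) ^+ 2 + M * gamma ^+ 2 * sigma' ^+ 2
    + 2 * gamma * edot (x - proj x) g
    + (gamma ^+ 2 * z1 + M * gamma ^+ 2 * z2)
  <= gamma ^+ 2 * enorm (g - F (proj x)) ^+ 2 + M * gamma ^+ 2 * sigma' ^+ 2
    + 2 * gamma * edot (x - proj x) (F x)
    + ((1 - r) * (enorm (x - proj x) ^+ 2 + M * gamma ^+ 2 * sigma ^+ 2)
       + gamma ^+ 2 * (D1 + M * D2)).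
Proof.
move=> pz z1_le z2_le.
have e1 : enorm (p - proj p) ^+ 2 <= enorm (p - proj x) ^+ 2.
  rewrite ler_sqr ?nnegrE ?enorm_ge0//.
  have := is_projection_min projP p (is_projection_mem projP x).
  by rewrite -(enormN (proj p - p)) -(enormN (proj x - p)) !opprB.
have e2 := is_prox_contraction Rg_proper Rg_convex gamma_gt0
  (is_projection_mem projP x) pz.
have q1 := F_qsm x; rewrite -/(gap F proj x) in q1.
have gapE : gap F proj x = edot (x - proj x) (F x) - edot (x - proj x) (F (proj x)).
  by rewrite /gap edotC edotDr edotNr.
have edotB u v : edot (u - gamma *: v) (u - gamma *: v) =
    edot u u - 2 * gamma * edot u v + gamma ^+ 2 * edot v v.
  by rewrite !edot_linear (edotC v u); ring.
move: e2; rewrite !enorm_sqr in e1 q1 *; rewrite edotB.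
rewrite [edot (x - proj x) (g - F _)]edotDr edotNr.
move: (x - proj x) q1 gapE => u q1 gapE e2.
have nu0 := edot_ge0 u; move: (edot u u) e2 nu0 q1 => nu e2 nu0 q1.
move: (gap F proj x) z1_le z2_le q1 gapE => gp z1_le z2_le q1 gapE.
have gp0 : 0 <= gp by apply: le_trans q1; rewrite mulr_ge0 // ltW.
have g2_ge0 := sqr_ge0 gamma.
(* The expansion contains -2 gamma gap: one half pays for the 2 gamma^2 (A + C M) gap of the two
   bounds, the other for r |u|^2. For sigma^2, [r_rho] gives B + M (1 - rho) <= M (1 - r). *)
have := ler_wpM2l g2_ge0 z1_le.
have := ler_wpM2l (mulr_ge0 M_ge0 g2_ge0) z2_le.
have := ler_wpM2l (mulr_ge0 (ltW gamma_gt0) gp0) gamma_le.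
have := ler_wpM2l (ltW gamma_gt0) q1.
have := ler_wpM2r nu0 r_mu.
have := ler_wpM2l (mulr_ge0 g2_ge0 (sqr_ge0 sigma)) r_rho.
rewrite gapE; lra.
Qed.

(** Integrates [sgda_descent] through [cond_exp_cancel], with V_{k+1} as [W] and (1 - r) V_k +
    gamma^2 (D1 + M D2) as [H]. *)
Lemma lyapunov_step (G : nat -> set (set T)) (x g : nat -> T -> 'rV[R]_d)
    (sigma : nat -> T -> R) k :
  is_filtration G ->
  (forall k, measurable_vec_wrt (G k) (x k)) ->
  (forall k, measurable_wrt (G k) (sigma k)) ->
  parametric_assumption P G F proj x g sigma A B C D1 D2 rho ->
  sgda Rg (fun=> gamma) x g ->
  ('E_P[lyapunov proj x sigma M gamma k.+1] <=
   (1 - r)%:E * 'E_P[lyapunov proj x sigma M gamma k]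
   + (gamma ^+ 2 * (D1 + M * D2))%:E)%E.
Proof.
move=> [sG GT _] mx ms [[_ _ _ D10 D20] _ _ /(_ k) [key_g key1 key2]] x_sgda.
have {key1} [Z1 Z1E Z1le] := key1.
have {key2} [Z2 Z2E Z2le] := key2.
have /choice[Yp /choice[Yn key_i]] := key_g.
pose gp i := (EFin \o (fun w => g k w ord0 i))^\+%E.
pose gn i := (EFin \o (fun w => g k w ord0 i))^\-%E.
have Yp_E i : is_cond_exp_ge0 P (G k) (gp i) (Yp i) by case: (key_i i).
have Yn_E i : is_cond_exp_ge0 P (G k) (gn i) (Yn i) by case: (key_i i).
have FY_ae : {ae P, forall w i, (F (x k w) ord0 i)%:E = (Yp i w - Yn i w)%E}.
  by apply: filter_forall => i; case: (key_i i).
set V := lyapunov proj x sigma M gamma.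
have c0 : 0 <= gamma ^+ 2 * (D1 + M * D2).
  by rewrite mulr_ge0 ?sqr_ge0// addr_ge0// mulr_ge0.
have mV j : measurable_fun [set: T] (V j).
  apply: (@measurable_wrt_measurable _ _ _ (sG j) (GT j)).
  exact: lyapunov_measurable_wrt (mx j) (ms j).
have V0 j w : 0 <= V j w by exact: lyapunov_ge0.
pose u w := x k w - proj (x k w).
have mu_ i : measurable_wrt (G k) (fun w => u w ord0 i).
  apply: (@measurable_fun_continuous_row _ (g_sigma_algebraType (G k)) _ _ (x k)
    (fun v => (v - proj v) ord0 i)) => [v|]; last exact: mx.
  apply: (@continuous_comp 'rV[R]_d 'rV[R]_d R (fun v => v - proj v)
    (fun v => v ord0 i)).
    exact: is_projection_residual_continuous projP _.
  exact: coord_continuous.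
pose a i w := 2 * gamma * Num.max (u w ord0 i) 0.
pose b i w := 2 * gamma * Num.max (- u w ord0 i) 0.
have a0 i w : 0 <= a i w by rewrite mulr_ge0 ?mulr_ge0 ?le_max ?lexx ?orbT// ltW.
have b0 i w : 0 <= b i w by rewrite mulr_ge0 ?mulr_ge0 ?le_max ?lexx ?orbT// ltW.
have ma i : measurable_wrt (G k) (a i).
  by apply: measurable_funM => //; apply: measurable_maxr => //; exact: mu_.
have mb i : measurable_wrt (G k) (b i).
  apply: measurable_funM => //; apply: measurable_maxr => //.
  by apply: measurableT_comp => //; exact: mu_.
(* Since [a - b] is 2 gamma u, the cross term 2 gamma <u, p - q> is [lin p q] minus [lin q p], where
   both terms are nonnegative for nonnegative [p] and [q]. *)
pose lin (p q : 'I_d -> T -> \bar R) w :=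
  (\sum_(i < d) ((a i w)%:E * p i w + (b i w)%:E * q i w))%E.
have linE p q p' q' : (forall i, is_cond_exp_ge0 P (G k) (p i) (p' i)) ->
    (forall i, is_cond_exp_ge0 P (G k) (q i) (q' i)) ->
    is_cond_exp_ge0 P (G k) (lin p q) (lin p' q').
  move=> pp' qq'; apply: is_cond_exp_ge0_sum => // i.
  by apply: is_cond_exp_ge0D => //; exact: is_cond_exp_ge0M.
have cE (c : R) X Y : 0 <= c -> is_cond_exp_ge0 P (G k) X Y ->
    is_cond_exp_ge0 P (G k) (fun w => c%:E * X w)%E (fun w => c%:E * Y w)%E.
  by move=> cge0; apply: is_cond_exp_ge0M => //; exact: measurable_cst.
have lin_fin p q p' q' w :
    (forall i, p i w = (p' i)%:E) -> (forall i, q i w = (q' i)%:E) ->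
    lin p q w = (\sum_(i < d) (a i w * p' i + b i w * q' i))%:E.
  move=> pE qE; rewrite /lin -sumEFin; apply: eq_bigr => i _.
  by rewrite pE qE EFinD !EFinM.
have X_E := linE _ _ _ _ Yp_E Yn_E.
have X'_E := is_cond_exp_ge0D (sG k) (GT k) (linE _ _ _ _ Yn_E Yp_E)
  (is_cond_exp_ge0D (sG k) (GT k) (cE _ _ _ (sqr_ge0 gamma) Z1E)
    (cE _ _ _ (mulr_ge0 M_ge0 (sqr_ge0 gamma)) Z2E)).
(* Nonnegative [Z1] and [Z2] lie below real numbers, and [Yp - Yn] is real, which excludes infinite
   values of either term. *)
have fin_ae : {ae P, forall w,
    [/\ forall i, Yp i w = (fine (Yp i w))%:E, forall i, Yn i w = (fine (Yn i w))%:E,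
        forall i, F (x k w) ord0 i = fine (Yp i w) - fine (Yn i w),
        exists2 z, Z1 w = z%:E &
          z <= 2 * A * gap F proj (x k w) + B * sigma k w ^+ 2 + D1 &
        exists2 z, Z2 w = z%:E &
          z <= 2 * C * gap F proj (x k w) + (1 - rho) * sigma k w ^+ 2 + D2]}.
  apply: filterS3 Z1le Z2le FY_ae => w Z1w Z2w Fw.
  have bounded z (c : R) : (0 <= z)%E -> (z <= c%:E)%E ->
      exists2 z', z = z'%:E & z' <= c.
    by case: z => [z| |]// _; rewrite lee_fin => zc; exists z.
  have FY i : [/\ Yp i w = (fine (Yp i w))%:E, Yn i w = (fine (Yn i w))%:E &
      F (x k w) ord0 i = fine (Yp i w) - fine (Yn i w)].
    case: (Yp_E i) => _ _ _ /(_ w) + _; case: (Yn_E i) => _ _ _ /(_ w) + _.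
    move: (Fw i); case: (Yp i w) => [p| |]//; case: (Yn i w) => [q| |]//.
    by rewrite -EFinB => -[->].
  split.
  - by move=> i; case: (FY i).
  - by move=> i; case: (FY i).
  - by move=> i; case: (FY i).
  - by case: Z1E => _ _ _ Z10 _; exact: bounded.
  - by case: Z2E => _ _ _ Z20 _; exact: bounded.
rewrite unlock.
have -> : ((1 - r)%:E * (\int[P]_w (V k w)%:E) + (gamma ^+ 2 * (D1 + M * D2))%:E =
  \int[P]_w ((1 - r) * V k w + gamma ^+ 2 * (D1 + M * D2))%:E)%E.
  under [RHS]eq_integral do rewrite EFinD EFinM.
  rewrite ge0_integralD//; last 2 first.
  - by move=> w _; rewrite -EFinM lee_fin mulr_ge0// subr_ge0.
  - by apply: emeasurable_funM => //; exact/measurable_EFinP.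
  rewrite integral_cst// [X in (_ = _ + _ * X)%E]probability_setT mule1.
  rewrite ge0_integralZl//.
  - exact/measurable_EFinP.
  - by move=> w _; rewrite lee_fin.
  - by rewrite lee_fin subr_ge0.
apply: (cond_exp_cancel (sG k) (GT k) X_E X'_E).
- apply: filterS fin_ae => w [YpE YnE _ [z1 Z1w _] [z2 Z2w _]].
  by rewrite (lin_fin _ _ _ _ _ YpE YnE) (lin_fin _ _ _ _ _ YnE YpE) Z1w Z2w ltry.
- exact/measurable_EFinP.
- by move=> w; rewrite lee_fin.
- by apply/measurable_EFinP/measurable_funD => //; exact: measurable_funM.
- by move=> w; rewrite lee_fin addr_ge0// mulr_ge0// subr_ge0.
apply: filterS fin_ae => w [YpE YnE FE [z1 Z1w z1_le] [z2 Z2w z2_le]].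
have := sgda_descent (sigma k.+1 w) (x_sgda k w) z1_le z2_le.
have lin_dot (p q : 'I_d -> R) (c : 'rV[R]_d) : (forall i, c ord0 i = p i - q i) ->
    \sum_(i < d) (a i w * p i + b i w * q i) =
    \sum_(i < d) (a i w * q i + b i w * p i) + 2 * gamma * edot (u w) c.
  move=> cpq; rewrite /edot mulr_sumr -big_split; apply: eq_bigr => i _ /=.
  by rewrite cpq -[in RHS](positive_part_sub (u w ord0 i)) /a /b; ring.
have gpE i : gp i w = (Num.max (g k w ord0 i) 0)%:E by rewrite /gp funeposE -EFin_max.
have gnE i : gn i w = (Num.max (- g k w ord0 i) 0)%:E by rewrite /gn funenegE -EFin_max.
rewrite (lin_fin _ _ _ _ _ gpE gnE) (lin_fin _ _ _ _ _ gnE gpE).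
rewrite (lin_fin _ _ _ _ _ YpE YnE) (lin_fin _ _ _ _ _ YnE YpE) Z1w Z2w.
rewrite -!EFinM -!EFinD lee_fin.
rewrite (lin_dot _ _ (g k w)); last by move=> i; rewrite positive_part_sub.
rewrite (lin_dot (fun i => fine (Yp i w)) (fun i => fine (Yn i w)) (F (x k w)))//.
rewrite /V /lyapunov -/(u w); lra.
Qed.

End Step.

(** * Unrolling the one-step recursion *)

Theorem theorem2p2 (R : realType) (d : nat)
    (disp : measure_display) (T : measurableType disp) (P : probability T R)
    (F : 'rV[R]_d -> 'rV[R]_d) (Rg : 'rV[R]_d -> \bar R)
    (Rg_proper : eproper Rg)
    (Rg_lsc : lower_semicontinuous Rg)
    (Rg_convex : econvex Rg)
    (Xs_neq0 : vi_solutions F Rg !=set0)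
    (proj : 'rV[R]_d -> 'rV[R]_d)
    (projP : is_projection (vi_solutions F Rg) proj)
    (mu : R) (mu_gt0 : 0 < mu)
    (F_qsm : quasi_strongly_monotone mu F proj)
    (G : nat -> set (set T)) (G_filtration : is_filtration G)
    (x g : nat -> T -> 'rV[R]_d) (sigma : nat -> T -> R)
    (x_adapted : forall k, measurable_vec_wrt (G k) (x k))
    (sigma_adapted : forall k, measurable_wrt (G k) (sigma k))
    (g_adapted : forall k, measurable_vec_wrt (G k.+1) (g k))
    (A B C D1 D2 rho : R)
    (key : parametric_assumption P G F proj x g sigma A B C D1 D2 rho)
    (* in the second case B / M = 0 / 0 = 0 *)
    (M : R) (M_cond : B / rho < M \/ (B = 0 /\ M = 0))
    (gamma : R) (gamma_gt0 : 0 < gamma)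
    (* inverses in \bar R, where 0^-1 = +oo *)
    (gamma_le :
      (gamma%:E <= mine (mu%:E)^-1 ((2 * (A + C * M))%R%:E)^-1)%E)
    (x_sgda : sgda Rg (fun=> gamma) x g)
    (k : nat) :
  ('E_P[lyapunov proj x sigma M gamma k]
   <= ((1 - Num.min (gamma * mu) (rho - B / M)) ^+ k)%:E
        * 'E_P[lyapunov proj x sigma M gamma 0]
      + (gamma ^+ 2 * (D1 + M * D2)
         / Num.min (gamma * mu) (rho - B / M))%:E)%E.
Proof.
have [[A0 B0 C0 D10 D20] /andP[rho0 rho1] _ _] := key.
set r := Num.min _ _.
have r_mu : r <= gamma * mu by rewrite ge_min lexx.
have r_rho' : r <= rho - B / M by rewrite ge_min lexx orbT.
(* The last bound is [r <= rho - B / M] multiplied out by [M], a form that also covers [B = M = 0],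
   where it reads 0 <= 0. *)
have [M0 BM r_rho] : [/\ 0 <= M, 0 < rho - B / M & B <= M * (rho - r)].
  case: M_cond => [BM|[-> ->]]; last first.
    by rewrite mul0r mul0r subr0.
  have M_gt0 : 0 < M by apply: le_lt_trans BM; rewrite divr_ge0// ltW.
  split; first exact: ltW.
    by rewrite subr_gt0 ltr_pdivrMr// mulrC -ltr_pdivrMr.
  by rewrite mulrC -ler_pdivrMr// lerBrDr addrC -lerBrDr.
have r_gt0 : 0 < r by rewrite lt_min BM mulr_gt0.
move: gamma_le; rewrite le_min => /andP[gamma_mu gamma_AC].
have gamma_mu1 : gamma * mu <= 1.
  by move: gamma_mu; rewrite inver gt_eqF// lee_fin -[_^-1]mul1r ler_pdivlMr.
have AC0 : 0 <= A + C * M by rewrite addr_ge0 ?mulr_ge0.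
have gamma_AC1 : 2 * gamma * (A + C * M) <= 1.
  (* If A + C M = 0, the stepsize bound is +oo and says nothing, but the product to be bounded is
     0. *)
  move: gamma_AC; rewrite inver; have [AC_eq0 _|AC_neq0] := eqVneq (2 * (A + C * M)) 0.
    by rewrite -mulrA mulrCA AC_eq0 mulr0 ler01.
  have AC_gt0 : 0 < 2 * (A + C * M) by rewrite lt_def AC_neq0 mulr_ge0.
  by rewrite lee_fin -[_^-1]mul1r ler_pdivlMr// mulrCA mulrA.
have r_le1 : r <= 1 by exact: le_trans gamma_mu1.
set c := gamma ^+ 2 * (D1 + M * D2).
have c0 : 0 <= c by rewrite mulr_ge0 ?sqr_ge0// addr_ge0// mulr_ge0.
have step j := lyapunov_step Rg_proper Rg_convex projP mu_gt0 F_qsm M0 gamma_gt0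
  r_le1 r_mu r_rho gamma_AC1 j G_filtration x_adapted sigma_adapted key x_sgda.
have E0 j : (0 <= 'E_P[lyapunov proj x sigma M gamma j])%E.
  by apply: expectation_ge0 => w; exact: lyapunov_ge0.
elim: k => [|k IHk].
  by rewrite expr0 mul1e leeDl// lee_fin divr_ge0// ltW.
apply: (le_trans (step k)).
have r1_ge0 : 0 <= 1 - r by rewrite subr_ge0.
apply: (le_trans (leeD2r _ (lee_wpmul2l _ IHk))); first by rewrite lee_fin.
rewrite ge0_muleDr; [|by rewrite mule_ge0// lee_fin exprn_ge0|
  by rewrite lee_fin divr_ge0// ltW].
rewrite muleA -EFinM -exprS -addeA -EFinM -EFinD.
rewrite leeD2l// lee_fin -/c.
(* [c / r] is the fixed point of t -> (1 - r) t + c, so the additive term reproduces itself. *)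
by rewrite mulrBl mul1r mulrCA divff ?gt_eqF// mulr1 subrK.
Qed.
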